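(* There exist a finite set of colors $C$ and a winning condition $W\subseteq C^\omega$ such that $\mathrm{GenMem}(W) = 2$ and $\mathrm{ChrMem}(W) = +\infty$.
   Context: Let $C$ be a non-empty set of colors. An arena over $C$ is a tuple $\langle V_P, V_A, E\rangle$ where $V_P, V_A, E$ are finite sets, $V_P\cap V_A=\varnothing$, $V=V_P\cup V_A\neq\varnothing$, $E\subseteq V\times C\times V$, and every node $s\in V$ has at least one edge $(s,c,t)\in E$. For an edge $e=(s,c,t)$ write $\mathrm{source}(e)=s$, $\mathrm{col}(e)=c$, $\mathrm{target}(e)=t$; $\mathrm{col}$ is extended letterwise to finite and infinite sequences of edges. A path is a non-empty finite or infinite sequence of edges $e_1e_2\ldots$ with $\mathrm{target}(e_i)=\mathrm{source}(e_{i+1})$; additionally each node $v$ has a $0$-length path $\lambda_v$ with source and target $v$. A Protagonist's strategy is a function $S$ mapping each finite path $p$ (including $0$-length ones) with $\mathrm{target}(p)\in V_P$ to an edge $S(p)$ with $\mathrm{source}(S(p))=\mathrm{target}(p)$. A path $e_1e_2\ldots$ is consistent with $S$ if (when $\mathrm{source}(e_1)\in V_P$) $e_1=S(\lambda_{\mathrm{source}(e_1)})$ and for each $i$ with $\mathrm{target}(e_i)\in V_P$ and $e_{i+1}$ existing, $e_{i+1}=S(e_1\ldots e_i)$. $S$ is winning from node $u$ w.r.t. $W\subseteq C^\omega$ if every infinite path consistent with $S$ starting at $u$ has color sequence in $W$. $S$ is optimal w.r.t. $W$ if there is no node $u$ from which some Protagonist's strategy is winning w.r.t. $W$ while $S$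 is not. A memory structure in the arena is $\mathcal M=\langle M,m_{init},\delta\rangle$ with $M$ finite, $m_{init}\in M$, $\delta\colon M\times E\to M$, extended to finite edge sequences by $\delta(m,\text{empty})=m$, $\delta(m,se)=\delta(\delta(m,s),e)$. It is chromatic if $\delta(m,e_1)=\delta(m,e_2)$ whenever $\mathrm{col}(e_1)=\mathrm{col}(e_2)$. A strategy $S$ is built on top of $\mathcal M$ if $S(p_1)=S(p_2)$ for all finite paths $p_1,p_2$ ending at the same Protagonist node with $\delta(m_{init},p_1)=\delta(m_{init},p_2)$; if $\mathcal M$ has $k$ states, $S$ is a strategy with $k$ states of general memory, and of chromatic memory if $\mathcal M$ is chromatic. $\mathrm{GenMem}(W)$ is the least $k\in\mathbb{Z}^+$ such that every arena over $C$ admits a Protagonist's strategy with $k$ states of general memory that is optimal w.r.t. $W$ ($+\infty$ if none exists); $\mathrm{ChrMem}(W)$ is defined likewise with chromatic memory. *)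

(* Defs.v *)
From mathcomp Require Import all_boot.
Set Implicit Arguments. Unset Strict Implicit. Unset Printing Implicit Defensive.

Section Games.
Variable C : finType.

(* An arena over C: finite node set V (nonempty), Protagonist nodes VP
   (Antagonist nodes VA := V \ VP, so VP and VA are disjoint and cover V),
   a finite edge set E ⊆ V × C × V, every node has an outgoing edge. *)
Record arena := Arena {
  anode : finType;
  aP : {set anode};
  aE : {set anode * C * anode};
  a_nonempty : 0 < #|anode|;
  a_out : forall s : anode, exists c t, (s, c, t) \in aE }.

Variable A : arena.

Definition edge := {e : anode A * C * anode A | e \in aE A}.
Definition src (e : edge) : anode A := (val e).1.1.
Definition ecol (e : edge) : C := (val e).1.2.
Definition tgt (e : edge) : anode A := (val e).2.

(* A finite path is a start node v together with a sequence of edges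
   e1 ... en with source e1 = v and target e_i = source e_(i+1);
   (v, [::]) is the 0-length path lambda_v. *)
Fixpoint fpath (v : anode A) (s : seq edge) : bool :=
  match s with
  | [::] => true
  | e :: s' => (src e == v) && fpath (tgt e) s'
  end.
Definition ptgt (v : anode A) (s : seq edge) : anode A := last v (map tgt s).

(* Protagonist's strategy: maps each finite path ending in VP to an edge
   leaving its target (values on other arguments are irrelevant). *)
Definition strat := anode A -> seq edge -> edge.
Definition is_strategy (S : strat) : Prop :=
  forall v s, fpath v s -> ptgt v s \in aP A -> src (S v s) = ptgt v s.

Definition consistent (S : strat) (u : anode A) (rho : nat -> edge) : Prop :=
  [/\ src (rho 0) = u,
      forall i, tgt (rho i) = src (rho i.+1),
      (u \in aP A -> rho 0 = S u [::]) &
      forall i, tgt (rho i) \in aP A -> rho i.+1 = S u (mkseq rho i.+1)].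

Definition winning (W : (nat -> C) -> Prop) (S : strat) (u : anode A) : Prop :=
  forall rho, consistent S u rho -> W (fun i => ecol (rho i)).

Definition optimal (W : (nat -> C) -> Prop) (S : strat) : Prop :=
  forall u, (exists S', is_strategy S' /\ winning W S' u) -> winning W S u.

Record memory := Memory {
  mstate : finType;
  minit : mstate;
  mdelta : mstate -> edge -> mstate }.

Definition mrun (M : memory) (s : seq edge) : @mstate M := foldl (@mdelta M) (@minit M) s.

Definition chromatic (M : memory) : Prop :=
  forall m e1 e2, ecol e1 = ecol e2 -> @mdelta M m e1 = @mdelta M m e2.

Definition built_on (S : strat) (M : memory) : Prop :=
  forall v1 s1 v2 s2, fpath v1 s1 -> fpath v2 s2 ->
    ptgt v1 s1 = ptgt v2 s2 -> ptgt v1 s1 \in aP A ->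
    mrun M s1 = mrun M s2 -> S v1 s1 = S v2 s2.

End Games.

Definition gen_adm (C : finType) (W : (nat -> C) -> Prop) (k : nat) : Prop :=
  forall A : arena C, exists S : strat A, is_strategy S /\ optimal W S /\
    exists M : memory A, #|@mstate _ _ M| = k /\ built_on S M.

Definition chr_adm (C : finType) (W : (nat -> C) -> Prop) (k : nat) : Prop :=
  forall A : arena C, exists S : strat A, is_strategy S /\ optimal W S /\
    exists M : memory A, #|@mstate _ _ M| = k /\ chromatic M /\ built_on S M.

(* least k in Z+ satisfying P; None encodes +infinity (no such k) *)
Definition least_pos (P : nat -> Prop) (m : option nat) : Prop :=
  match m with
  | Some k => 0 < k /\ P k /\ (forall j, 0 < j -> j < k -> ~ P j)
  | None => forall k, 0 < k -> ~ P k
  end.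

Definition GenMem_is C W m := least_pos (@gen_adm C W) m.
Definition ChrMem_is C W m := least_pos (@chr_adm C W) m.

(* Main.v *)
Require Import Defs.
From mathcomp Require Import all_boot.
From mathcomp Require Import boolp zify.

(* Colors act as monotone maps on the levels nat x {0,1}, where a point is below
   another iff they are equal or its level is strictly smaller, and Protagonist
   wins iff the orbit of a fixed point stays bounded. In a finite arena he then
   wins with a uniform bound, so at each node the values from which he wins form a
   bounded down-set; as levels have width two, it has at most two maximal elements,
   and it suffices to remember which of them dominates the current value. For
   chromatic memory the second component is the obstacle: two words ending at the
   same level may differ in it according to whether one color occurred at a time
   which is a power of two, and a finite automaton cannot tell this. *)

Set Implicit Arguments. Unset Strict Implicit. Unset Printing Implicit Defensive.

(** * Levels of width two, their down-sets, and bounded orbits *)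

Definition lvl_le (x y : nat * bool) : bool := (x == y) || (x.1 < y.1).

Lemma lvl_le_refl x : lvl_le x x.
Proof. by rewrite /lvl_le eqxx. Qed.

Lemma lvl_le_trans y x z : lvl_le x y -> lvl_le y z -> lvl_le x z.
Proof.
rewrite /lvl_le => /orP[/eqP->//|xy] /orP[/eqP<-|yz]; first by rewrite xy orbT.
by rewrite (ltn_trans xy yz) orbT.
Qed.

Lemma lvl_le_fst x y : lvl_le x y -> x.1 <= y.1.
Proof. by case/orP=> [/eqP->|/ltnW]. Qed.

(* A bounded down-set has at most two maximal elements. The one covering [x0] is
   listed first because the initial memory state may not depend on the node. *)
Lemma downset_cover (D : nat * bool -> Prop) N x0 :
    (forall x y, lvl_le x y -> D y -> D x) ->
    (forall x, D x -> x.1 <= N) -> (exists x, D x) ->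
  exists r : bool -> nat * bool,
    [/\ forall m, D (r m), forall x, D x -> exists m, lvl_le x (r m) &
        D x0 -> lvl_le x0 (r false)].
Proof.
move=> Dle DN [x Dx].
pose Q n := `[< exists b, D (n, b) >].
have exQ : exists n, Q n by exists x.1; apply/asboolP; exists x.2; case: (x) Dx.
have QN n : Q n -> n <= N by move=> /asboolP[b /DN].
case: (ex_maxnP exQ QN) => n /asboolP[b0 Db0] nmax.
(* At the top level [n], the second component of [x0] itself is taken; if [x0] lies strictly lower,
   any element of level [n] dominates it. *)
have [b Db x0b] : exists2 b, D (n, b) & D x0 -> lvl_le x0 (n, b).
  have [Dx0|nDx0] := pselect (D x0); last by exists b0.
  have := nmax x0.1; rewrite leq_eqVlt => /(_ _)/orP[|/eqP x0n|x0n].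
  - by apply/asboolP; exists x0.2; case: (x0) Dx0.
  - exists x0.2; rewrite -x0n; first by case: (x0) Dx0.
    by case: (x0) => ? ? _; apply: lvl_le_refl.
  - by exists b0 => // _; rewrite /lvl_le x0n orbT.
exists (fun m => if m && `[< D (n, ~~ b) >] then (n, ~~ b) else (n, b)).
split=> [m|[k c] Dy|]; last by [].
  by case: asboolP => Dn; rewrite ?andbT ?andbF //; case: m.
have := nmax k; rewrite leq_eqVlt => /(_ _)/orP[|/eqP kn|kn].
- by apply/asboolP; exists c.
- subst k; have [->|cb] := eqVneq c b; first by exists false; exact: lvl_le_refl.
  have {}cb : c = ~~ b by case: c b cb {Db x0b Dy} => [] [].
  subst c; exists true; move/asboolP: Dy => -> /=; exact: lvl_le_refl.
- by exists false; rewrite /lvl_le /= kn orbT.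
Qed.

Definition orbit_val (C : Type) (upd : C -> nat * bool -> nat * bool) x0 (w : nat -> C) i :=
  foldl (fun x c => upd c x) x0 (mkseq w i).

Lemma orbit_valS C upd x0 (w : nat -> C) i :
  orbit_val upd x0 w i.+1 = upd (w i) (orbit_val upd x0 w i).
Proof. by rewrite /orbit_val mkseqS foldl_rcons. Qed.

Definition bounded_orbit (C : Type) (upd : C -> nat * bool -> nat * bool) x0 (w : nat -> C) :=
  exists N, forall i, (orbit_val upd x0 w i).1 <= N.

(** * Finite histories and plays *)

Section Paths.
Variables (C : finType) (A : arena C).
Implicit Types (u v : anode A) (s : seq (edge A)) (e : edge A).

Lemma ptgt_rcons u s e : ptgt u (rcons s e) = tgt e.
Proof. by rewrite /ptgt map_rcons last_rcons. Qed.

Lemma fpath_rcons u s e : Defs.fpath u (rcons s e) = Defs.fpath u s && (src e == ptgt u s).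
Proof.
elim: s u => [|e' s IH] u /=; first by rewrite andbT.
by rewrite IH andbA.
Qed.

Lemma exists_edge v : exists e : edge A, src e = v.
Proof. by have [c [t vt]] := a_out v; exists (exist _ (v, c, t) vt). Qed.

Lemma ptgt_mkseq u (rho : nat -> edge A) :
    src (rho 0) = u -> (forall i, tgt (rho i) = src (rho i.+1)) ->
  forall i, ptgt u (mkseq rho i) = src (rho i).
Proof. by move=> h0 hS [//|i]; rewrite mkseqS ptgt_rcons hS. Qed.

Lemma consistent_at (S : strat A) u rho i :
  consistent S u rho -> src (rho i) \in aP A -> rho i = S u (mkseq rho i).
Proof.
by case=> r0 rS rP0 rPS; case: i => [|i]; [rewrite r0; exact: rP0 | rewrite -rS; exact: rPS].
Qed.

Lemma exists_play (S : strat A) u (ch : seq (edge A) -> edge A) :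
    is_strategy S -> (forall s, src (ch s) = ptgt u s) ->
  exists2 rho, consistent S u rho &
    forall i, src (rho i) \notin aP A -> rho i = ch (mkseq rho i).
Proof.
move=> Sstrat chs.
pose next s := if ptgt u s \in aP A then S u s else ch s.
pose hist := fix hist i := if i is j.+1 then rcons (hist j) (next (hist j)) else [::].
pose rho i := next (hist i).
have histE i : mkseq rho i = hist i by elim: i => //= i IH; rewrite mkseqS IH.
have next_src s : Defs.fpath u s -> src (next s) = ptgt u s.
  by move=> us; rewrite /next; case: ifP => // uP; apply: Sstrat.
have hist_path i : Defs.fpath u (hist i).
  by elim: i => //= i IH; rewrite fpath_rcons IH next_src // eqxx.
have rho_src i : src (rho i) = ptgt u (hist i) by apply: next_src.
exists rho; first split=> [|i|uP|i iP].
- by rewrite rho_src.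
- by rewrite rho_src /= ptgt_rcons.
- by rewrite /rho /next /= uP.
- by rewrite histE /rho {1}/next /= ptgt_rcons iP.
by move=> i; rewrite rho_src histE => /negPf uP; rewrite /rho /next uP.
Qed.

End Paths.

(** * Two states of general memory, via safety games with bounded level *)

Section GeneralMemory.
Variables (C : finType) (upd : C -> nat * bool -> nat * bool) (x0 : nat * bool).
Hypothesis upd_mono : forall c x y, lvl_le x y -> lvl_le (upd c x) (upd c y).

Section Safety.
Variable A : arena C.

Definition step (e : edge A) x := upd (ecol e) x.

Definition hval (s : seq (edge A)) := foldl (fun x e => step e x) x0 s.

Lemma orbit_val_hval (rho : nat -> edge A) i :
  orbit_val upd x0 (fun i => ecol (rho i)) i = hval (mkseq rho i).
Proof. by elim: i => //= i IH; rewrite orbit_valS IH mkseqS /hval foldl_rcons. Qed.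

Definition safe_closed N (Q : anode A -> nat * bool -> Prop) := forall v x, Q v x ->
  [/\ x.1 <= N,
      v \in aP A -> exists2 e, src e = v & Q (tgt e) (step e x) &
      v \notin aP A -> forall e, src e = v -> Q (tgt e) (step e x)].

(** The greatest closed set, encoded coinductively: the positions from which Protagonist can keep
    the level at most [N] forever. *)
Definition safe N v x := exists2 Q, safe_closed N Q & Q v x.

Lemma safe_safe_closed N : safe_closed N (safe N).
Proof.
move=> v x [Q Qcl Qvx]; have [xN QP QA] := Qcl _ _ Qvx; split=> // [vP|vA e ev].
  by have [e ev Qe] := QP vP; exists e => //; exists Q.
by exists Q => //; exact: QA.
Qed.

(** Since updates are monotone, the down-closure of a closed set is closed. *)
Lemma safe_le N v x y : lvl_le x y -> safe N v y -> safe N v x.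
Proof.
move=> xy [Q Qcl Qvy].
exists (fun w z => exists2 z', lvl_le z z' & Q w z'); last by exists y.
move=> w z [z' zz' Qz']; have [zN QP QA] := Qcl _ _ Qz'; split=> [|wP|wA e ew].
- exact: leq_trans (lvl_le_fst zz') zN.
- have [e ew Qe] := QP wP; exists e => //; exists (step e z') => //.
  exact: upd_mono.
- exists (step e z'); [exact: upd_mono | exact: QA].
Qed.

Lemma safe_widen N N' v x : N <= N' -> safe N v x -> safe N' v x.
Proof.
move=> NN' [Q Qcl Qvx]; exists Q => // w y /Qcl[yN QP QA]; split=> //.
exact: leq_trans NN'.
Qed.

(** * Unbounded plays from positions safe for no bound *)

Section Unbounded.
Variables (S : strat A) (u : anode A).
Hypothesis S_strat : is_strategy S.

Definition chist (s : seq (edge A)) := Defs.fpath u s /\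
  forall t e t', s = rcons t e ++ t' -> ptgt u t \in aP A -> e = S u t.

Lemma chist_rcons s e : chist s -> src e = ptgt u s ->
  (ptgt u s \in aP A -> e = S u s) -> chist (rcons s e).
Proof.
move=> [us sP] es eP; split=> [|t f t']; first by rewrite fpath_rcons us es eqxx.
case/lastP: t' => [|t' f']; first by rewrite cats0 => /rcons_inj[<- <-].
by rewrite -rcons_cat => /rcons_inj[st _]; apply: sP st.
Qed.

Lemma chist_prefix s s' : chist (s ++ s') -> chist s.
Proof.
move=> [us sP]; split=> [|t e t' st]; last by apply: (sP t e (t' ++ s')); rewrite st catA.
by elim: s u us {sP} => //= e s IH v /andP[-> /IH].
Qed.

Definition bad s := chist s /\ forall N, ~ safe N (ptgt u s) (hval s).

(* The values reachable in one step from level at most [N] are finitely many,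
   so a single bound serves all the safe positions among them. *)
Lemma safe_uniform N : exists N', forall e y, y.1 <= N ->
  (exists K, safe K (tgt e) (step e y)) -> safe N' (tgt e) (step e y).
Proof.
have /choice[K KP] (p : edge A * ('I_N.+1 * bool)) : exists K,
    let y := (val p.2.1, p.2.2) in
    (exists K, safe K (tgt p.1) (step p.1 y)) -> safe K (tgt p.1) (step p.1 y).
  have [[K sK]|nK] := pselect (exists K,
    safe K (tgt p.1) (step p.1 (val p.2.1, p.2.2))); first by exists K.
  by exists 0.
exists (\max_p K p) => e [n b] /= nN sK.
have nN' : n < N.+1 by [].
have := KP (e, (Ordinal nN', b)) sK; apply: safe_widen.
exact: (leq_bigmax (e, (Ordinal nN', b))).
Qed.

(* Otherwise the values on unsafe consistent extensions of [s] together with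
   the safe positions one step away would witness that [s] itself is safe. *)
Lemma bad_extend s : bad s -> forall N, exists t, bad (s ++ t) /\ N < (hval (s ++ t)).1.
Proof.
move=> [cs ns] N; apply: contrapT => /forallNP noext.
have [N' N'P] := safe_uniform N.
apply: (ns (maxn N N')).
exists (fun w y => (exists t, [/\ bad (s ++ t), w = ptgt u (s ++ t) & y = hval (s ++ t)])
                   \/ safe N' w y); last first.
  by left; exists [::]; rewrite cats0.
move=> w y [[t [bt -> ->]]|sy]; last first.
  have [yN QP QA] := safe_safe_closed sy; split=> [|wP|wA e ew].
  - by rewrite leq_max yN orbT.
  - by have [e ew se] := QP wP; exists e => //; right.
  - by right; apply: QA.
have yN : (hval (s ++ t)).1 <= N.
  by rewrite leqNgt; apply/negP => lt; apply: (noext t).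
have next e : src e = ptgt u (s ++ t) ->
    (ptgt u (s ++ t) \in aP A -> e = S u (s ++ t)) ->
    (exists t', [/\ bad (s ++ t'), tgt e = ptgt u (s ++ t') &
                    step e (hval (s ++ t)) = hval (s ++ t')]) \/
    safe N' (tgt e) (step e (hval (s ++ t))).
  move=> es eP; have ce := chist_rcons bt.1 es eP.
  have [sK|nK] := pselect (exists K, safe K (tgt e) (step e (hval (s ++ t)))).
    by right; apply: N'P.
  left; exists (rcons t e).
  rewrite -rcons_cat ptgt_rcons /hval foldl_rcons; split=> //.
  split=> // K sK; apply: nK; exists K.
  by rewrite ptgt_rcons /hval foldl_rcons in sK.
split=> [|wP|wA e ew]; first by rewrite leq_max yN.
- have srcS : src (S u (s ++ t)) = ptgt u (s ++ t) by apply: S_strat wP; exact: bt.1.1.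
  by exists (S u (s ++ t)) => //; exact: next.
- by apply: next => // wP; rewrite wP in wA.
Qed.

Lemma bad_play : bad [::] -> exists2 rho, consistent S u rho &
  ~ bounded_orbit upd x0 (fun i => ecol (rho i)).
Proof.
move=> bad0.
(* Each extension lifts the level above the current level, hence is nonempty, and above the current
   length, hence makes the levels unbounded. *)
have /choice[ext extP] (s : seq (edge A)) : exists t, forall N, bad s ->
    N = maxn (size s) (hval s).1 -> bad (s ++ t) /\ N < (hval (s ++ t)).1.
  have [bs|nbs] := pselect (bad s); last by exists [::].
  have [t tP] := bad_extend bs (maxn (size s) (hval s).1).
  by exists t => N _ ->.
pose h := fix h i := if i is j.+1 then h j ++ ext (h j) else [::].
have hbad i : bad (h i) by elim: i => //= i IH; case: (extP _ _ IH erefl).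
have hS i : [/\ size (h i) < size (h i.+1) & size (h i) < (hval (h i.+1)).1].
  have [_] := extP _ _ (hbad i) erefl; rewrite gtn_max => /andP[-> lt].
  split=> //=; rewrite size_cat -[X in X < _]addn0 ltn_add2l lt0n.
  by apply: contraL lt => /nilP ->; rewrite cats0 ltnn.
have hsize i : i <= size (h i).
  by elim: i => // i IH; apply: leq_ltn_trans IH _; case: (hS i).
have hpre i j : i <= j -> exists t, h j = h i ++ t.
  elim: j => [|j IH]; first by rewrite leqn0 => /eqP ->; exists [::].
  rewrite leq_eqVlt => /orP[/eqP ->|/IH[t jt]]; first by exists [::]; rewrite cats0.
  by exists (t ++ ext (h j)); rewrite /= {1}jt catA.
have [e0 _] := exists_edge u.
(* The histories [h] form a chain of prefixes, and [h i.+1] is long enough to fix edge [i]; the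
   default [e0] is never read. *)
pose rho i := nth e0 (h i.+1) i.
have rhoE i n : n <= size (h i) -> mkseq rho n = take n (h i).
  move=> ni; apply: (@eq_from_nth _ e0); first by rewrite size_mkseq size_takel.
  move=> k; rewrite size_mkseq => kn; rewrite nth_mkseq // nth_take // /rho.
  case: (leqP k.+1 i) => [/hpre[t ->]|ik]; first by rewrite nth_cat hsize.
  have [t ->] := hpre i k.+1 (ltnW ik).
  by rewrite nth_cat (leq_trans kn ni).
have rhoC n : chist (rcons (mkseq rho n) (rho n)).
  rewrite -mkseqS (rhoE n.+1) //; apply: (@chist_prefix _ (drop n.+1 (h n.+1))).
  by rewrite cat_take_drop; case: (hbad n.+1).
have rhoP n : ptgt u (mkseq rho n) \in aP A -> rho n = S u (mkseq rho n).
  by case: (rhoC n) => [_ P]; apply: (P _ _ [::]); rewrite cats0.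
have rho_src n : src (rho n) = ptgt u (mkseq rho n).
  by have [+ _] := rhoC n; rewrite fpath_rcons => /andP[_ /eqP].
exists rho.
  split=> [||uP|i iP]; first exact: rho_src.
  - by move=> i; rewrite rho_src mkseqS ptgt_rcons.
  - exact: (rhoP 0).
  - by apply: rhoP; rewrite mkseqS ptgt_rcons.
case=> N NP; have [_] := hS N; apply/negP; rewrite -leqNgt.
apply: leq_trans (hsize N); apply: leq_trans (NP (size (h N.+1))).
have -> : h N.+1 = mkseq rho (size (h N.+1)) by rewrite (rhoE N.+1) // take_size.
by rewrite size_mkseq orbit_val_hval.
Qed.

End Unbounded.

(** At a node safe for no bound, [bad_play] defeats every strategy; as nodes are finitely many, one
    bound serves all winnable ones. *)
Lemma safe_bound : exists N, forall u,
  (exists S, is_strategy S /\ winning (bounded_orbit upd x0) S u) -> safe N u x0.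
Proof.
have /choice[K KP] (u : anode A) : exists K,
    (exists S, is_strategy S /\ winning (bounded_orbit upd x0) S u) -> safe K u x0.
  have [[K sK]|nK] := pselect (exists K, safe K u x0); first by exists K.
  exists 0 => -[S [Sstrat Swin]].
  have [|rho cons] := @bad_play S u Sstrat; last by case; exact: Swin.
  split; last by move=> N sN; apply: nK; exists N.
  by split=> // -[].
exists (\max_u K u) => u /KP; apply: safe_widen; exact: (leq_bigmax u).
Qed.

Lemma safe_cover N v : exists r : bool -> nat * bool,
  (exists x, safe N v x) ->
    [/\ forall m, safe N v (r m), forall x, safe N v x -> exists m, lvl_le x (r m) &
        safe N v x0 -> lvl_le x0 (r false)].
Proof.
have [vs|nvs] := pselect (exists x, safe N v x); last by exists (fun=> x0) => /nvs.
have [r rP] := @downset_cover (safe N v) N x0 (fun x y => @safe_le N v x y)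
  (fun x xs => let: And3 xN _ _ := safe_safe_closed xs in xN) vs.
by exists r.
Qed.

End Safety.

(** Protagonist plays as if the current value were the maximal safe value [r v m]; by monotonicity
    the actual value stays below it. *)
Lemma bounded_orbit_gen_adm2 : gen_adm (bounded_orbit upd x0) 2.
Proof.
move=> A; have [N NP] := safe_bound A.
have [r rP] := choice (@safe_cover A N).
have safe_r v x m : safe N v x -> safe N v (r v m).
  by move=> vx; case: (rP v (ex_intro _ x vx)).
have /choice[E EP] (vm : anode A * bool) : exists e : edge A, src e = vm.1 /\
    (vm.1 \in aP A -> (exists x, safe N vm.1 x) ->
     safe N (tgt e) (step e (r vm.1 vm.2))).
  case: vm => v m /=; have [e0 e0v] := exists_edge v.
  have [[vP [x vx]]|nv] := pselect (v \in aP A /\ exists x, safe N v x); last first.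
    by exists e0; split=> // vP vs; case: nv.
  have [_ QP _] := safe_safe_closed (safe_r _ _ m vx).
  by have [e ev es] := QP vP; exists e.
(* The new bit names a maximal element at the target that dominates the image of the old one; this
   reads the endpoints of [e], not just its color. *)
pose dl m e := ~~ lvl_le (step e (r (src e) m)) (r (tgt e) false).
pose M := @Memory C A bool false dl.
exists (fun v s => E (ptgt v s, mrun M s)).
have Es v s : src (E (ptgt v s, mrun M s)) = ptgt v s by case: (EP (ptgt v s, mrun M s)).
split=> [v s _ _|]; first exact: Es.
split; last by exists M; split=> [|v1 s1 v2 s2 _ _ -> _ ->//]; rewrite card_bool.
move=> u /NP us rho cons; have [rho0 rhoS _ _] := cons.
have src_rho := ptgt_mkseq rho0 rhoS.
suff inv i : (exists x, safe N (src (rho i)) x) /\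
    lvl_le (orbit_val upd x0 (fun i => ecol (rho i)) i)
           (r (src (rho i)) (mrun M (mkseq rho i))).
  exists N => i; have [[x xs] /lvl_le_fst le] := inv i.
  by apply: leq_trans le _; case: (safe_safe_closed (safe_r _ _ (mrun M (mkseq rho i)) xs)).
elim: i => [|i [[x xs] IH]].
  rewrite rho0; split; first by exists x0.
  by have [_ _] := rP u (ex_intro _ x0 us); apply.
set m := mrun M (mkseq rho i) in IH *.
have sS : safe N (src (rho i.+1)) (step (rho i) (r (src (rho i)) m)).
  rewrite -rhoS; case: (boolP (src (rho i) \in aP A)) => [iP|iA].
    have := consistent_at cons iP; rewrite src_rho -/m => rhoi.
    have [_ sE] := EP (src (rho i), m).
    by rewrite {1 2}rhoi; apply: sE => //; exists x.
  by have [_ _] := safe_safe_closed (safe_r _ _ m xs); apply.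
split; first by eexists; exact: sS.
rewrite orbit_valS mkseqS /mrun foldl_rcons -/(mrun _ _) -/m /=.
apply: lvl_le_trans (upd_mono _ IH) _.
rewrite /dl rhoS; have [_ cov _] := rP _ (ex_intro _ _ sS).
case: (boolP (lvl_le _ (r _ false))) => // nle.
by have [[] le] := cov _ sS => //; rewrite le in nle.
Qed.

End GeneralMemory.

(** * Eventual periodicity, and the condition testing powers of two *)

Lemma iter_collision (T : finType) (f : T -> T) :
  exists i p, [/\ 0 < p, i + p <= #|{ffun T -> T}| & iter (i + p) f =1 iter i f].
Proof.
set K := #|{ffun T -> T}|.
(* Pigeonhole on the iterates as whole functions, so that [i] and [p] serve every starting state. *)
pose F (i : 'I_K.+1) := [ffun m => iter i f m].
have : ~~ injectiveb F.
  by apply/negP => /injectiveP/leq_card; rewrite card_ord ltnn.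
case/injectivePn => i [j ij Fij].
wlog lt : i j ij Fij / i < j.
  move=> th; have := ij; rewrite neq_ltn => /orP[lt|lt]; first exact: th lt.
  by apply: th lt => //; rewrite eq_sym.
exists i, (j - i); split; [lia | have := ltn_ord j; lia |].
by rewrite subnKC 1?ltnW // => m; have /ffunP/(_ m) := Fij; rewrite !ffunE.
Qed.

Definition pow2 n := n == 2 ^ trunc_log 2 n.

Lemma pow2_expn n : pow2 (2 ^ n).
Proof. by rewrite /pow2 trunc_expnK. Qed.

Lemma pow2_between n p : 0 < p -> p < 2 ^ n -> pow2 (2 ^ n + p) = false.
Proof.
move=> p0 pn; rewrite /pow2 (@trunc_log_eq _ n) //; first by apply/negbTE; lia.
by rewrite expnS; lia.
Qed.

(* Level 0 absorbs the raising colors [(true, b)], so Protagonist is safe once he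
   has reached it with the lowering colors [(false, b)]. Plays start at level 1,
   so [pow2 m] tests the number [m] of raising steps made so far. *)
Definition pow2_upd (c : bool * bool) (x : nat * bool) : nat * bool :=
  if c.1 then
    if x.1 is m.+1 then (m.+2, x.2 (+) (c.2 && pow2 m)) else x
  else (if x.2 == c.2 then x.1.-1 else x.1, c.2).

(** Raising keeps levels strictly ordered. Lowering subtracts at most one and overwrites the second
    component, so levels that become equal give equal values. *)
Lemma pow2_upd_mono c x y : lvl_le x y -> lvl_le (pow2_upd c x) (pow2_upd c y).
Proof.
case/orP=> [/eqP->|]; first exact: lvl_le_refl.
case: c x y => [[] b] [n x] [n' y] /=; rewrite /pow2_upd /lvl_le /=.
  by case: n n' => [|n] [|n'] //= nn'; apply/orP; right.
rewrite -pair_eqE /pair_eq /= eqxx andbT => nn'.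
have : (if x == b then n.-1 else n) <= (if y == b then n'.-1 else n').
  by case: ifP => _; case: ifP => _; lia.
by rewrite leq_eqVlt.
Qed.

Notation ladder_win := (bounded_orbit pow2_upd (1, false)).

(** * The ladder arenas *)

Section Ladder.
Variable L : nat.
Hypothesis L_gt0 : 0 < L.

Definition lnode := 'I_L.*2.+2.
Definition lup (v : lnode) := (v < L) || (v == L.*2.+1 :> nat).
Definition lnext (v : lnode) : lnode := inord (minn v.+1 L.*2.+1).
(** Successor and first color component are forced; a player chooses only the second component. *)
Definition ledges := [set e : lnode * (bool * bool) * lnode |
  (e.1.2.1 == lup e.1.1) && (e.2 == lnext e.1.1)].

Lemma lnode_nonempty : 0 < #|{: lnode}|.
Proof. by rewrite card_ord. Qed.

Lemma ledge_proof (v : lnode) b : (v, (lup v, b), lnext v) \in ledges.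
Proof. by rewrite inE !eqxx. Qed.

Lemma lnode_out (v : lnode) : exists c t, (v, c, t) \in ledges.
Proof. by exists (lup v, false), (lnext v); apply: ledge_proof. Qed.

(* Antagonist owns the first [L] nodes, a path of level-raising edges; Protagonist
   then makes [L + 1] level-lowering moves and ends up in a raising loop. *)
Definition ladder : arena (bool * bool)%type :=
  Arena [set v : lnode | L <= v] lnode_nonempty lnode_out.

Definition ledge (v : lnode) b : edge ladder :=
  exist (fun e => e \in ledges) _ (ledge_proof v b).

Lemma edge_col (e : edge ladder) : (ecol e).1 = lup (src e).
Proof. by have := valP e; rewrite inE => /andP[/eqP]. Qed.

Lemma edge_tgt (e : edge ladder) : tgt e = lnext (src e).
Proof. by have := valP e; rewrite inE => /andP[_ /eqP]. Qed.

Lemma aP_ladder (v : lnode) : (v \in aP ladder) = (L <= v).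
Proof. by rewrite inE. Qed.

Lemma src_play (rho : nat -> edge ladder) i :
    src (rho 0) = ord0 -> (forall i, tgt (rho i) = src (rho i.+1)) ->
  src (rho i) = minn i L.*2.+1 :> nat.
Proof.
move=> r0 rS; elim: i => [|i IH]; first by rewrite r0.
rewrite -rS edge_tgt /lnext IH inordK; lia.
Qed.

(** Knowing the whole history, Protagonist always matches the second component, so the [L + 1]
    lowering moves bring level [L + 1] down to the absorbing level 0. *)
Lemma ladder_winnable : exists S : strat ladder, is_strategy S /\ winning ladder_win S ord0.
Proof.
exists (fun (v : lnode) (s : seq (edge ladder)) =>
  ledge (@ptgt _ ladder v s) (hval pow2_upd (1, false) s).2); split=> // rho cons.
have [r0 rS _ _] := cons; exists L.+1 => i; move: i.
pose x := orbit_val pow2_upd (1, false) (fun i => ecol (rho i)).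
suff inv i : (x i).1 = if i <= L then i.+1 else L.*2.+1 - i.
  by move=> i; have := inv i; rewrite /x => ->; case: ifP; lia.
have srcE i := src_play i r0 rS.
elim: i => // i IH; rewrite /x orbit_valS -/(x i) /pow2_upd edge_col /lup srcE.
case: ifP => [up|nup].
  case E: (x i).1 IH => [|m] /=; [rewrite E|]; do 2 case: ifP; lia.
have /= -> : rho i = ledge (src (rho i)) (x i).2.
  rewrite {1}(consistent_at cons) ?aP_ladder ?srcE; last lia.
  by rewrite (ptgt_mkseq r0 rS) /x orbit_val_hval.
by rewrite eqxx IH /=; do 2 case: ifP; lia.
Qed.

Section Play.
Variables (S : strat ladder) (n : nat).
Hypothesis S_strat : is_strategy S.

Definition up_word : seq (edge ladder) := mkseq (fun i => ledge (inord i) (i == n)) L.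

Lemma play_along : exists2 rho, consistent S ord0 rho & mkseq rho L = up_word.
Proof.
have [s|rho cons rhoP] := @exists_play _ _ S ord0
  (fun s : seq (edge ladder) => ledge (@ptgt _ ladder ord0 s) (size s == n)) S_strat;
  first by [].
exists rho => //; have [r0 rS _ _] := cons.
apply/eq_in_map => i; rewrite mem_iota /= add0n => iL.
have srcE : src (rho i) = inord i.
  by apply: val_inj; rewrite /= (src_play _ r0 rS) inordK; lia.
rewrite rhoP ?size_mkseq ?(ptgt_mkseq r0 rS) ?srcE //.
by rewrite aP_ladder inordK; lia.
Qed.

(* A wrong first move wastes one of the [L + 1] lowering steps, so the level is
   still positive when the raising loop is entered. *)
Lemma wrong_bit_loses : n < L -> (ecol (S ord0 up_word)).2 != pow2 n ->
  ~ winning ladder_win S ord0.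
Proof.
move=> nL wrong /(_ _) win; have [rho cons word] := play_along.
have {win} := win _ cons => -[N NP].
have [r0 rS _ _] := cons.
pose x := orbit_val pow2_upd (1, false) (fun i => ecol (rho i)).
have srcE i := src_play i r0 rS.
have xS i : x i.+1 = pow2_upd (ecol (rho i)) (x i) by rewrite /x orbit_valS.
(* The level at time [i] is [i.+1], so the single mark, made at time [n], tests [pow2 n]. *)
have xup i : i <= L -> x i = (i.+1, (n < i) && pow2 n).
  elim: i => // i IH iL; rewrite xS IH ?(ltnW iL) // /pow2_upd edge_col /lup srcE.
  have rhoi : rho i = ledge (inord i) (i == n).
    have := congr1 (fun s => nth (rho 0) s i) word.
    by rewrite !nth_mkseq.
  rewrite ifT; last lia.
  rewrite /= rhoi /ecol /= ltnS.
  by case: (ltngtP i n) => [||->] //=; rewrite ?addbF.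
have xdown i : L < i <= L.*2.+1 -> L.*2.+2 - i <= (x i).1.
  elim: i => // i IH iL; rewrite xS /pow2_upd edge_col /lup srcE ifF /=; last lia.
  have [iE|iL'] := eqVneq i L; last first.
    have {}IH := IH ltac:(lia); case: ifP => _; lia.
  subst i; have -> : rho L = S ord0 up_word.
    by rewrite (consistent_at cons) ?word // aP_ladder srcE; lia.
  rewrite xup //= nL /= eq_sym (negPf wrong); lia.
have xloop i : i < (x (L.*2.+1 + i)).1.
  elim: i => [|i IH]; first by rewrite addn0; have := xdown L.*2.+1; lia.
  rewrite addnS xS /pow2_upd edge_col /lup srcE ifT; last lia.
  by case: (x _).1 IH.
by have := leq_trans (xloop N) (NP (L.*2.+1 + N)); rewrite ltnn.
Qed.

Lemma up_word_path :
  @Defs.fpath _ ladder ord0 up_word /\ @ptgt _ ladder ord0 up_word = inord L.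
Proof.
have [rho [r0 rS _ _] <-] := play_along; rewrite (ptgt_mkseq r0 rS); split; last first.
  by apply: val_inj; rewrite /= (src_play _ r0 rS) inordK; lia.
suff path_rho i : @Defs.fpath _ ladder ord0 (mkseq rho i) by [].
by elim: i => // i IH; rewrite mkseqS fpath_rcons IH (ptgt_mkseq r0 rS) eqxx.
Qed.

End Play.

(** A chromatic memory cannot tell the raising edges apart by node, so each acts like an edge at
    [ord0] with the same bit. *)
Lemma mrun_up_word (M : memory ladder) n : chromatic M -> n < L ->
  mrun M (up_word n) =
  iter (L - n.+1) ((@mdelta _ _ M)^~ (ledge ord0 false))
    (mdelta (iter n ((@mdelta _ _ M)^~ (ledge ord0 false)) (minit M)) (ledge ord0 true)).
Proof.
move=> chrM nL; pose a m c := @mdelta _ _ M m (ledge ord0 c).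
have step m i : i < L -> mdelta m (ledge (inord i) (i == n)) = a m (i == n).
  move=> iL; apply: chrM; rewrite /ecol /= /lup inordK; last lia.
  by rewrite iL L_gt0.
have run i : i <= L -> mrun M (mkseq (fun i => ledge (inord i) (i == n)) i) =
    if i <= n then iter i (a^~ false) (minit M)
    else iter (i - n.+1) (a^~ false) (a (iter n (a^~ false) (minit M)) true).
  elim: i => // i IH iL.
  rewrite mkseqS /mrun foldl_rcons -/(mrun _ _) (IH (ltnW iL)) step //.
  case: (ltngtP i n) => [//|lt|->]; last by rewrite subnn.
  by rewrite (subSn lt).
by rewrite run // leqNgt nL.
Qed.

End Ladder.

(* Since [2 ^ K] is the only power of two in a long window, moving the
   color [(true, true)] by a period [p] of the memory flips the final bit undetected. *)
Lemma chr_not_adm k : ~ chr_adm ladder_win k.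
Proof.
(* [K] counts the self-maps of the memory and bounds preperiod plus period; the summand [K.*2.+1]
   leaves at least a preperiod of steps after the later mark. *)
move=> adm; pose K := k ^ k; pose L := 2 ^ K + K.*2.+1.
have L0 : 0 < L by rewrite /L; lia.
have [S [Sstrat [Sopt [M [cardM [chrM SM]]]]]] := adm (ladder L).
have Swin := Sopt ord0 (ladder_winnable L0).
pose f m := @mdelta _ _ M m (ledge (ord0 : lnode L) false).
have [i [p [p0 ipK per]]] := iter_collision f.
rewrite card_ffun cardM -/K in ipK.
have KT : K < 2 ^ K by apply: ltn_expl.
have {}per j : i <= j -> iter (j + p) f =1 iter j f.
  by move=> ij m; rewrite -(subnK ij) -addnA iterD per -iterD.
have same : mrun M (up_word L (2 ^ K)) = mrun M (up_word L (2 ^ K + p)).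
  rewrite !mrun_up_word //; try by rewrite /L; lia.
  (* One period is cancelled after the mark in the first word and before the mark in the second. *)
  have -> : L - (2 ^ K).+1 = L - (2 ^ K + p).+1 + p by rewrite /L; lia.
  rewrite -/f !per //; first by lia.
  by rewrite /L; lia.
have [p1 t1] := up_word_path L0 (2 ^ K) Sstrat.
have [p2 t2] := up_word_path L0 (2 ^ K + p) Sstrat.
have SE : S ord0 (up_word L (2 ^ K)) = S ord0 (up_word L (2 ^ K + p)).
  apply: SM; rewrite ?t1 ?t2 // aP_ladder inordK; lia.
have bit n : n < L -> (ecol (S ord0 (up_word L n))).2 = pow2 n.
  by move=> nL; apply/eqP; apply: contraPT Swin => w; apply: wrong_bit_loses w.
have := bit (2 ^ K) ltac:(rewrite /L; lia); rewrite SE bit; last by rewrite /L; lia.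
by rewrite pow2_expn pow2_between //; lia.
Qed.

Theorem theorem1 :
  exists (C : finType) (W : (nat -> C) -> Prop),
    0 < #|C| /\ GenMem_is W (Some 2) /\ ChrMem_is W None.
Proof.
exists (bool * bool)%type, ladder_win; split; first by rewrite card_prod card_bool.
split; last by move=> k _; exact: chr_not_adm.
split=> //; split; first by apply: bounded_orbit_gen_adm2; exact: pow2_upd_mono.
(* A one-state memory is chromatic, so the chromatic lower bound also excludes one state of general
   memory. *)
case=> [|[|j]] // _ _ adm; apply: (@chr_not_adm 1) => A.
have [S [Sstrat [Sopt [M [M1 SM]]]]] := adm A.
exists S; split=> //; split=> //; exists M; split=> //; split=> // m e1 e2 _.
by move/eq_leq/fintype_le1P: M1; apply.
Qed.
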